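(* Consider the rounded quantized VCG mechanism (defined in the context) with a given $\epsilon$. If the number of partitions $M$ is even and the monetary unit is set to $\delta=\frac{\epsilon}{M}$, then it is an $\frac{\epsilon}{2}$-dominant strategy for agent $n$ to report $$\hat w_{nm}=\begin{cases}\lceil\frac{\hat v_{nm}}{\delta}\rceil, & 0<m\le\frac M2,\\ \lfloor\frac{\hat v_{nm}}{\delta}\rfloor, & \frac M2<m\le M.\end{cases}$$ If all agents play this strategy, the maximum difference between the social welfare given by the quantized VCG mechanism and that given by the rounded quantized VCG mechanism is $\eta=\epsilon=M\delta$.
   Context: Setting: $\mathcal N=\{1,\dots,N\}$ is the set of agents. $f:2^{\mathcal N}\to\mathbb R$ is normalized ($f(\emptyset)=0$), monotone and submodular, with $f(\mathcal N)=1$ and strictly positive minimum distance $\triangle f=\min_{S\subseteq\mathcal N}\min_{i\ne j\in\mathcal N\setminus S}|f(S\cup\{i\})+f(S\cup\{j\})-f(S)-f(S\cup\{i,j\})|$. A divisible resource is to be allocated, with feasible allocations $\mathbf x\in\mathbb R_+^N$ satisfying $\sum_{n\in S}x_n\le f(S)$ for all $S\subseteq\mathcal N$. The resource is partitioned into $M$ equal divisions, where $M$ is an integer with $M\ge 2/\triangle f$. Let $\tilde f(S)=\lfloor f(S)M\rfloor$ and $P_{\tilde f}=\{\mathbf y\in\mathbb N^N:\sum_{n\in S}y_n\le\tilde f(S)\ \forall S\subseteq\mathcal N\}$, which is an integral polymatroid; $y_n$ is the number of divisions given to agent $n$. Each agent $n$ has a private utility function $u_n$ of her allocation that is nonnegative,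 concave and strictly increasing with $\beta<u_n'<\alpha$, where $\alpha,\beta>0$ are publicly known constants. The true surrogate marginal utilities are $\hat v_{nm}=u_n(\frac mM)-u_n(\frac{m-1}M)-\frac\beta M$, $1\le m\le\tilde f(\{n\})$ (an agent submits only the bids with $m\le\tilde f(\{n\})\le M$). Quantized VCG mechanism: each agent $n$ submits a surrogate marginal utility vector $\hat V_n=(\hat v_{n1},\dots,\hat v_{n\tilde f(\{n\})})$. The allocation $\mathbf y^*\in P_{\tilde f}$ maximizes $\sum_n\left(\sum_{m=1}^{y_n}\hat v_{nm}+\frac{\beta y_n}{M}\right)$ over $\mathbf y\in P_{\tilde f}$, and $\mathrm{OPT}(\hat V)=\sum_n\sum_{m=1}^{y_n^*}\hat v_{nm}$. Agent $n$ receives $y_n^*/M$ and pays $p_n=\mathrm{OPT}(0,\hat V_{-n})-\left(\mathrm{OPT}(\hat V)-\sum_{m=1}^{y_n^*}\hat v_{nm}\right)+\frac{y_n^*\beta}{M}$, where $(0,\hat V_{-n})$ is $\hat V$ with agent $n$'s vector replaced by zero. Truthful reporting is a weakly dominant strategy, and the social welfare given by this mechanism is that under truthful reports, namely $\max_{\mathbf y\in P_{\tilde f}}\sum_n u_n(y_n/M)$. Rounded quantized VCG mechanism with monetary unit $\delta$: each agent $n$ submits a non-increasing integer vector $\hat W_n=(\hat w_{n1},\dots,\hat w_{n\tilde f(\{n\})})$, and the quantized VCG mechanism (allocation and payments) is run with the vectors $\hat V_n=\hat W_n\delta$, ties being broken randomly. If $\tilde{\mathbf y}^*$ is the resulting allocation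 of divisions, the social welfare given by this mechanism is $\sum_n u_n(\tilde y_n^*/M)$, evaluated with the true utilities. Agent $n$'s payoff is $u_n(\tilde y_n^*/M)-p_n$. For $\epsilon'\ge0$, a strategy $\sigma_n^*$ of agent $n$ is $\epsilon'$-dominant if for all strategies $\sigma_n$ of agent $n$ and all strategies $\sigma_{-n}$ of the other agents, agent $n$'s payoff under $(\sigma_n,\sigma_{-n})$ exceeds her payoff under $(\sigma_n^*,\sigma_{-n})$ by at most $\epsilon'$.
   Formalization: Bids whose reported marginal utility (bid times δ plus β/M) is exactly zero are excluded, since OPT and payments then depend on tie-breaking; the maximum welfare difference is read as a supremum over all environments with given M and ε, as it is never attained. *)

(* Defs.v *)
From HB Require Import structures.
From mathcomp Require Import all_boot all_order all_algebra.
From mathcomp Require Import all_classical all_reals all_analysis.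

Set Implicit Arguments.
Unset Strict Implicit.
Unset Printing Implicit Defensive.

Import Order.TTheory GRing.Theory Num.Theory.
Import numFieldNormedType.Exports.

Local Open Scope classical_set_scope.
Local Open Scope ring_scope.

(* For N < 2 the index set is empty and [inf] returns 0, so that positivity of
   the minimum distance requires at least two agents; otherwise the set is
   finite and nonempty and [inf] is its minimum. *)
Definition min_distance (R : realType) (N : nat) (f : {set 'I_N} -> R) : R :=
  inf [set d : R | exists (S : {set 'I_N}) (i j : 'I_N),
    [/\ i \notin S, j \notin S, i != j &
        d = `|f (i |: S)%SET + f (j |: S)%SET - f S
              - f (i |: (j |: S))%SET|]].

(* At the endpoint 0 only continuity is required: by concavity the right
   derivative at 0 is then the limit of the interior derivatives. *)
Definition utility (R : realType) (alpha beta : R) (u : R -> R) : Prop :=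
  [/\ {in `[0, +oo[, forall x, 0 <= u x},
      convex_function (`[0, +oo[ : set R) (fun x => - u x),
      {in `[0, +oo[ &, {homo u : x y / x < y}},
      {within `[0, +oo[, continuous u} &
      {in `]0, +oo[, forall x, derivable u x 1 /\ beta < derive1 u x < alpha}].

Record environment (R : realType) (M : nat) := Environment {
  agents : nat;
  f : {set 'I_agents} -> R;
  alpha : R;
  beta : R;
  u : 'I_agents -> R -> R;
  f_normalized : f finset.set0 = 0;
  f_monotone : forall A B : {set 'I_agents}, A \subset B -> f A <= f B;
  f_submodular : forall A B : {set 'I_agents},
    f (A :|: B)%SET + f (A :&: B)%SET <= f A + f B;
  f_total : f [set: 'I_agents]%SET = 1;
  min_distance_gt0 : 0 < min_distance f;
  divisions_ge : 2 / min_distance f <= M%:R;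
  alpha_gt0 : 0 < alpha;
  beta_gt0 : 0 < beta;
  u_utility : forall n, utility alpha beta (u n)
}.

Arguments agents {R M}.
Arguments f {R M}.
Arguments alpha {R M}.
Arguments beta {R M}.
Arguments u {R M}.

Definition replace (N : nat) (T : Type) (s : 'I_N -> T) (n : 'I_N) (t : T) :
  'I_N -> T := fun k => if k == n then t else s k.

Section Mechanisms.
Variables (R : realType) (M : nat) (E : environment R M).

Notation N := (agents E).
Notation allocation := {ffun 'I_N -> nat}.

Definition ftilde (S : {set 'I_N}) : nat := Num.truncn (f E S * M%:R).

Definition feasible (y : allocation) : Prop :=
  forall S : {set 'I_N}, (\sum_(n in S) y n <= ftilde S)%N.

(* The entry [V n m] stands for the m-th marginal (m >= 1) of agent n.  Entries
   with m = 0 or m > ftilde [set n] are never read on feasible allocations. *)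
Definition reported_value (v : nat -> R) (k : nat) : R :=
  \sum_(1 <= m < k.+1) v m.

Definition surrogate_welfare (V : 'I_N -> nat -> R) (y : allocation) : R :=
  \sum_n reported_value (V n) (y n).

Definition objective (V : 'I_N -> nat -> R) (y : allocation) : R :=
  \sum_n (reported_value (V n) (y n) + beta E * (y n)%:R / M%:R).

(* Relational: every maximizer is a possible result of the tie-breaking. *)
Definition vcg_outcome (V : 'I_N -> nat -> R) (y : allocation) : Prop :=
  feasible y /\ forall z, feasible z -> objective V z <= objective V y.

(* [y] is an outcome for [V] and [z] one for (0, V_{-n}), so that OPT is read
   off as [surrogate_welfare V y] and [surrogate_welfare _ z] respectively. *)
Definition payment (V : 'I_N -> nat -> R) (n : 'I_N) (y z : allocation) : R :=
  surrogate_welfare (replace V n (fun=> 0)) z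
  - (surrogate_welfare V y - reported_value (V n) (y n))
  + (y n)%:R * beta E / M%:R.

Definition payoff (V : 'I_N -> nat -> R) (n : 'I_N) (y z : allocation) : R :=
  u E n ((y n)%:R / M%:R) - payment V n y z.

Definition social_welfare (y : allocation) : R :=
  \sum_n u E n ((y n)%:R / M%:R).

Definition true_marginal (n : 'I_N) (m : nat) : R :=
  u E n (m%:R / M%:R) - u E n (m.-1%:R / M%:R) - beta E / M%:R.

Definition scaled (delta : R) (W : 'I_N -> nat -> int) : 'I_N -> nat -> R :=
  fun n m => (W n m)%:~R * delta.

(* The second condition excludes a reported marginal utility that is exactly
   zero: allocating such a division or not leaves the objective unchanged while
   changing the surrogate welfare, and OPT would not be determined by the
   reports.  It holds for all nonnegative reports. *)
Definition is_bid (delta : R) (n : 'I_N) (w : nat -> int) : Prop :=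
  (forall m m' : nat, (1 <= m)%N -> (m <= m')%N ->
     (m' <= ftilde [set n]%SET)%N -> w m' <= w m) /\
  (forall m : nat, (1 <= m <= ftilde [set n]%SET)%N ->
     (w m)%:~R * delta + beta E / M%:R != 0).

Definition dominant (delta eps' : R) (n : 'I_N) (s : nat -> int) : Prop :=
  is_bid delta n s /\
  forall (w : nat -> int) (W : 'I_N -> nat -> int),
    is_bid delta n w -> (forall k, k != n -> is_bid delta k (W k)) ->
    let V := scaled delta (replace W n s) in
    let V' := scaled delta (replace W n w) in
    forall y z y' z' : allocation,
      vcg_outcome V y -> vcg_outcome (replace V n (fun=> 0)) z ->
      vcg_outcome V' y' -> vcg_outcome (replace V' n (fun=> 0)) z' ->
      payoff V' n y' z' <= payoff V n y z + eps'.

Definition rounded_report (delta : R) (n : 'I_N) (m : nat) : int :=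
  if (m <= M./2)%N then Num.ceil (true_marginal n m / delta)
  else Num.floor (true_marginal n m / delta).

End Mechanisms.

Arguments true_marginal {R M} E n m.
Arguments rounded_report {R M} E delta n m.
Arguments dominant {R M} E delta eps' n s.

Definition welfare_differences (R : realType) (M : nat) (delta : R) : set R :=
  [set d | exists (E : environment R M) (y z : {ffun 'I_(agents E) -> nat}),
     [/\ vcg_outcome (true_marginal E) y,
         vcg_outcome (scaled delta (rounded_report E delta)) z &
         d = `|social_welfare y - social_welfare z|]].

(* Main.v *)
(* Rounding up on the first half and down on the second half makes the
   accumulated rounding error of an agent unimodal with peak at M/2, so that it
   varies by at most (M/2) delta; this gives eps/2-dominance once one knows that
   OPT does not depend on the tie-breaking and that units missing from an
   allocation can be completed by units of the deviating agent.

   For the welfare, ftilde is submodular thanks to the bound on M, so a true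
   optimum y can be moved to a rounded optimum z by symmetric exchanges of units.
   A unit costs delta, or 2 delta if it is taken from an agent i with
   z_i >= M/2; in the latter case at most M/2 units are exchanged in total.
   Hence the loss is at most M delta.  It is approached by two agents with linear
   utilities: truthfully the first gets everything, while after rounding it is
   optimal to share the resource equally. *)
Require Import Defs.
From mathcomp Require Import all_boot all_order all_algebra.
From mathcomp Require Import all_classical all_reals all_analysis.
From mathcomp Require Import zify ring lra.

Set Implicit Arguments.
Unset Strict Implicit.
Unset Printing Implicit Defensive.

Import Order.TTheory GRing.Theory Num.Theory.
Import numFieldNormedType.Exports.

Local Open Scope classical_set_scope.
Local Open Scope ring_scope.

(** * Submodularity from a two-point condition, and sums that differ in one or two terms *)

Definition submodular {T : finType} (g : {set T} -> nat) : Prop :=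
  forall A B : {set T}, (g (A :|: B)%SET + g (A :&: B)%SET <= g A + g B)%N.

(** Removing the points of [C :\: A] one at a time turns the two-point inequality into decreasing
    marginals ([marg]); removing those of [A :\: B] one at a time then gives the full inequality.
    The two-point form is the one that the minimum distance controls. *)
Lemma submodular_local {T : finType} (g : {set T} -> nat) :
  (forall (S : {set T}) (i j : T), i \notin S -> j \notin S -> i != j ->
     (g S + g (i |: (j |: S))%SET <= g (i |: S)%SET + g (j |: S)%SET)%N) ->
  submodular g.
Proof.
move=> loc.
have marg (A C : {set T}) i : A \subset C -> i \notin C ->
    (g A + g (i |: C)%SET <= g (i |: A)%SET + g C)%N.
  have [n] := ubnP #|(C :\: A)%SET|; elim: n C => // n IH C ltn AC iC.
  have [CA0|[j]] := finset.set_0Vmem (C :\: A)%SET.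
    have -> : C = A; last by lia.
    by apply/eqP; rewrite finset.eqEsubset AC andbT -finset.setD_eq0 CA0.
  rewrite finset.inE => /andP[jA jC].
  have ij : i != j by apply: contraNneq iC => ->.
  have := loc (C :\ j)%SET i j; rewrite finset.setD1K //.
  rewrite !finset.inE eqxx ij (negbTE iC) => /(_ isT isT isT) l1.
  have := IH (C :\ j)%SET; rewrite finset.subsetD1 AC jA finset.inE (negbTE iC) andbF.
  move=> /(_ _ isT isT) => l2; suff: (#|(C :\ j) :\: A|%SET < n)%N by move/l2; lia.
  rewrite -ltnS; apply: leq_trans ltn; rewrite !ltnS; apply: proper_card.
  apply/properP; split; first by apply: finset.setSD; apply: finset.subD1set.
  by exists j; rewrite !finset.inE ?eqxx ?jA ?jC ?andbF.
move=> A B; have [n] := ubnP #|(A :\: B)%SET|; elim: n A => // n IH A ltn.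
have [AB0|[i]] := finset.set_0Vmem (A :\: B)%SET.
  have AB : A \subset B by rewrite -finset.setD_eq0 AB0.
  by rewrite (finset.setUidPr AB) (finset.setIidPl AB) addnC.
rewrite finset.inE => /andP[iB iA].
have/IH : (#|(A :\ i) :\: B|%SET < n)%N.
  rewrite -ltnS; apply: leq_trans ltn; rewrite !ltnS; apply: proper_card.
  apply/properP; split; first by apply: finset.setSD; apply: finset.subD1set.
  by exists i; rewrite !finset.inE ?eqxx ?iB ?iA ?andbF.
have -> : ((A :\ i) :&: B = A :&: B)%SET.
  apply/finset.setP => k; rewrite !finset.inE.
  by have [->|] := eqVneq k i; rewrite ?(negbTE iB) ?andbF.
have := marg (A :\ i)%SET (A :\ i :|: B)%SET i (finset.subsetUl _ _).
rewrite !finset.inE eqxx (negbTE iB) => /(_ isT).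
rewrite finset.setUA finset.setD1K //; lia.
Qed.

Lemma sum_shift {R : zmodType} {T : finType} (F G : T -> R) (i j : T) :
  i != j -> (forall k, k != i -> k != j -> F k = G k) ->
  \sum_k F k - \sum_k G k = (F i - G i) + (F j - G j).
Proof.
move=> ij FG; rewrite -sumrB (bigD1 i) //= (bigD1 j) ?(eq_sym j) //=.
by rewrite big1 ?addr0 // => k /andP[ki kj]; rewrite FG // subrr.
Qed.

Lemma sum_shift1 {R : zmodType} {T : finType} (F G : T -> R) (i : T) :
  (forall k, k != i -> F k = G k) -> \sum_k F k - \sum_k G k = F i - G i.
Proof.
move=> FG; rewrite -sumrB (bigD1 i) //= big1 ?addr0 // => k ki.
by rewrite FG // subrr.
Qed.

Lemma sum_setT {T : finType} (F : T -> nat) :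
  (\sum_(k in [set: T]%SET) F k = \sum_k F k)%N.
Proof. by apply: eq_bigl => k; rewrite finset.in_setT. Qed.

(** * Integral polymatroids: tight sets, augmentation and symmetric exchange *)

Section Polymatroid.
Context {T : finType}.
Implicit Types (g : {set T} -> nat) (y z : {ffun T -> nat}) (A B S : {set T}).

Definition inc y i : {ffun T -> nat} := [ffun k => (y k + (k == i))%N].
Definition exch y i j : {ffun T -> nat} :=
  [ffun k => (y k + (k == i) - (k == j))%N].
Definition polymatroid g y : Prop := forall S, (\sum_(n in S) y n <= g S)%N.

Lemma sum_eq_op i S : (\sum_(k in S) (k == i) = (i \in S))%N.
Proof.
have [iS|iS] := boolP (i \in S).
  by rewrite (bigD1 i) //= eqxx big1 // => k /andP[_ /negbTE ->].
rewrite big1 // => k kS; case: eqVneq => // ki; by rewrite -ki kS in iS.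
Qed.

Lemma sum_inc y i S :
  (\sum_(k in S) inc y i k = \sum_(k in S) y k + (i \in S))%N.
Proof. by under eq_bigr do rewrite ffunE; rewrite big_split /= sum_eq_op. Qed.

Lemma sum_exch y i j S : i != j -> (0 < y j)%N ->
  (\sum_(k in S) exch y i j k + (j \in S) = \sum_(k in S) y k + (i \in S))%N.
Proof.
move=> ij yj; rewrite -!sum_eq_op -!big_split /=; apply: eq_bigr => k _.
rewrite ffunE subnK //; have [->|//] := eqVneq k j; lia.
Qed.

Definition tight g y S : bool := (\sum_(n in S) y n == g S)%N.

Lemma sum_setUI y A B :
  (\sum_(k in (A :|: B)%SET) y k + \sum_(k in (A :&: B)%SET) y k =
   \sum_(k in A) y k + \sum_(k in B) y k)%N.
Proof.
have sumE S : (\sum_(k in S) y k = \sum_k (k \in S) * y k)%N.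
  by rewrite big_mkcond; apply: eq_bigr => k _; case: ifP; rewrite ?mul1n ?mul0n.
rewrite !sumE -!big_split; apply: eq_bigr => k _ /=.
by rewrite !finset.inE; case: (k \in A); case: (k \in B) => /=; lia.
Qed.

(** The sum of [y] is modular and [g] submodular, so the nonnegative slacks of the union and the
    intersection add up to at most 0. *)
Lemma tightUI g y A B : submodular g -> polymatroid g y ->
  tight g y A -> tight g y B ->
  (tight g y (A :|: B)%SET) && (tight g y (A :&: B)%SET).
Proof.
rewrite /tight => sub yP /eqP tA /eqP tB.
have := sub A B; have := sum_setUI y A B.
have := yP (A :|: B)%SET; have := yP (A :&: B)%SET; lia.
Qed.

Lemma not_inc_tight g y i : polymatroid g y -> ~ polymatroid g (inc y i) ->
  exists2 S, tight g y S & i \in S.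
Proof.
move=> yP /existsNP[S]; rewrite sum_inc => /negP; rewrite -ltnNge.
move=> lt; exists S; have := yP S; rewrite /tight; lia.
Qed.

Lemma tight_cover g y A : submodular g -> g finset.set0 = 0%N ->
  polymatroid g y -> (forall i, i \in A -> ~ polymatroid g (inc y i)) ->
  exists2 X, tight g y X & A \subset X.
Proof.
move=> sub g0 yP nA.
exists (\bigcup_(S | tight g y S) S)%SET.
  elim/big_ind: _ => // [|B C tB tC].
    by rewrite /tight finset.big_set0 g0.
  by have /andP[] := tightUI sub yP tB tC.
apply/fintype.subsetP => i /nA/not_inc_tight -/(_ yP)[S tS iS].
by apply/finset.bigcupP; exists S.
Qed.

(** Otherwise all points with [y i < z i] lie in one tight set [X]. Inside [X] the total of [z] is
    at most [g X], which [y] attains; outside [X], [z] is pointwise at most [y]. *)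
Lemma polymatroid_augment g y z : submodular g -> g finset.set0 = 0%N ->
  polymatroid g y -> polymatroid g z -> (\sum_k y k < \sum_k z k)%N ->
  exists2 i, (y i < z i)%N & polymatroid g (inc y i).
Proof.
move=> sub g0 yP zP yz; apply: contrapT => /forall2NP nex.
have [i|X tX AX] := @tight_cover g y [set i | (y i < z i)%N]%SET sub g0 yP.
  by rewrite finset.inE => lt; case: (nex i).
move: yz; rewrite (bigID (mem X)) [leqRHS](bigID (mem X)) /= ltnNge.
move=> /negP; apply; apply: leq_add.
  by rewrite (eqP tX); apply: zP.
apply: leq_sum => i iX; rewrite leqNgt; apply: contra iX => iyz.
by apply: (fintype.subsetP AX); rewrite finset.inE.
Qed.

Lemma polymatroid_maximal g y : submodular g -> g finset.set0 = 0%N ->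
  polymatroid g y -> (forall i, ~ polymatroid g (inc y i)) ->
  (\sum_k y k = g [set: T]%SET)%N.
Proof.
move=> sub g0 yP nA.
have [//|X tX] := @tight_cover g y [set: T]%SET sub g0 yP.
by rewrite finset.subTset => /eqP XT; move: tX; rewrite XT /tight sum_setT => /eqP.
Qed.

(* Uncrossing the least z-tight set containing [i] with the largest y-tight set
   avoiding [i]. *)
Lemma polymatroid_exchange g y z i : submodular g -> g finset.set0 = 0%N ->
  polymatroid g y -> polymatroid g z ->
  (\sum_k z k = g [set: T]%SET)%N -> (z i < y i)%N ->
  exists j, [/\ (y j < z j)%N, polymatroid g (exch y j i)
    & polymatroid g (exch z i j)].
Proof.
move=> sub g0 yP zP zT zy.
pose D := (\bigcap_(S | (tight g z S) && (i \in S)) S)%SET.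
pose X := (\bigcup_(S | (tight g y S) && (i \notin S)) S)%SET.
have tT : tight g z [set: T]%SET.
  by rewrite /tight -zT sum_setT.
have /andP[tD iD] : (tight g z D) && (i \in D).
  rewrite /D; elim/big_ind: _ => //.
    by rewrite tT finset.in_setT.
  move=> A B /andP[tA iA] /andP[tB iB].
  by have /andP[_ ->] := tightUI sub zP tA tB; rewrite finset.inE iA iB.
have /andP[tX iX] : (tight g y X) && (i \notin X).
  rewrite /X; elim/big_ind: _ => //.
    by rewrite /tight finset.big_set0 g0 finset.in_set0.
  move=> A B /andP[tA iA] /andP[tB iB].
  have /andP[-> _] := tightUI sub yP tA tB.
  by rewrite finset.inE negb_or iA iB.
(* If [z <= y] held throughout [D :\: X], strictly at [i], then submodularity at [D] and [X], both
   tight, would be violated. *)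
have [j [jD jX jyz]] : exists j, [/\ j \in D, j \notin X & (y j < z j)%N].
  apply: contrapT => nex.
  have lt :
      (\sum_(k in (D :\: X)%SET) z k < \sum_(k in (D :\: X)%SET) y k)%N.
    have iDX : i \in (D :\: X)%SET by rewrite finset.inE iX iD.
    rewrite (bigD1 i) //= [leqRHS](bigD1 i) //= -addSn leq_add //.
    apply: leq_sum => k /andP[]; rewrite finset.inE => /andP[kX kD] _.
    by rewrite leqNgt; apply/negP => kyz; apply: nex; exists k.
  have := sub D X; have := yP (D :|: X)%SET; have := zP (D :&: X)%SET.
  have := sum_setUI y D X.
  have := @finset.big_setID _ _ addn _ D X (fun k => y k).
  have := @finset.big_setID _ _ addn _ D X (fun k => z k).
  move: tD tX; rewrite /tight => /eqP <- /eqP <-; simpl; lia.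
have ij : i != j by apply: contraTneq jyz => <-; lia.
(* The first exchange can only break a [y]-tight set containing [j] but not [i], and such a set lies
   in [X]. The second can only break a [z]-tight set containing [i] but not [j], and such a set
   contains [D]. *)
exists j; split=> // S.
  have := @sum_exch y j i S; rewrite eq_sym => /(_ ij (leq_ltn_trans (leq0n _) zy)).
  have := yP S.
  have [iS|iS] := boolP (i \in S); first by case: (j \in S); clear; lia.
  have [jS|jS] := boolP (j \in S); last by clear; lia.
  rewrite leq_eqVlt => /orP[tS|]; last by clear; lia.
  case/negP: jX; apply/finset.bigcupP; exists S => //.
  by rewrite /tight tS iS.
have := @sum_exch z i j S ij (leq_ltn_trans (leq0n _) jyz); have := zP S.
have [jS|jS] := boolP (j \in S); first by case: (i \in S); clear; lia.
have [iS|iS] := boolP (i \in S); last by clear; lia.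
rewrite leq_eqVlt => /orP[tS|]; last by clear; lia.
case/negP: jS; move/finset.bigcapP: jD; apply.
by rewrite /tight tS iS.
Qed.

End Polymatroid.

(** * Value lost along a sequence of exchanges under decreasing marginals *)

Lemma reported_valueS {R : realType} (v : nat -> R) k :
  reported_value v k.+1 = reported_value v k + v k.+1.
Proof. by rewrite /reported_value big_nat_recr. Qed.

Definition antitone_marginals {R : realType} (v : nat -> R) : Prop :=
  forall m m', (0 < m)%N -> (m <= m')%N -> v m' <= v m.

(* Each step moves one unit of [y] from some [i] to some [j] toward [z]; by
   concavity it costs at most [v i (z i).+1 - v j (z j)], whatever [y] is. *)
Lemma exchange_loss {R : realType} {T : finType} (g : {set T} -> nat)
    (v : T -> nat -> R) (c d : T -> R) (y z : {ffun T -> nat}) :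
  submodular g -> g finset.set0 = 0%N -> polymatroid g y -> polymatroid g z ->
  (\sum_k y k = g [set: T]%SET)%N -> (\sum_k z k = g [set: T]%SET)%N ->
  (forall i, antitone_marginals (v i)) ->
  (forall i j, i != j -> (0 < z j)%N -> polymatroid g (exch z i j) ->
     v i (z i).+1 - v j (z j) <= c i + d j) ->
  \sum_k reported_value (v k) (y k) - \sum_k reported_value (v k) (z k) <=
  \sum_k ((y k - z k)%:R * c k + (z k - y k)%:R * d k).
Proof.
move=> sub g0 yP zP yT zT vanti step.
have [n] := ubnP (\sum_k (y k - z k))%N; elim: n y yP yT => // n IH y yP yT ltn.
have [nex|] := boolP [forall i, (y i <= z i)%N].
  have yz : y = z.
    apply/ffunP => i; apply/eqP; rewrite eqn_leq (forallP nex) /= leqNgt.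
    apply/negP => lt; suff : (\sum_k y k < \sum_k z k)%N by rewrite yT zT ltnn.
    rewrite (bigD1 i) //= [ltnRHS](bigD1 i) //= -addSn leq_add //.
    by apply: leq_sum => k _; apply: (forallP nex).
  by rewrite yz subrr big1 // => k _; rewrite subnn !mul0r addr0.
rewrite negb_forall => /existsP[i]; rewrite -ltnNge => zyi.
have [j [yzj yP' zP']] := polymatroid_exchange sub g0 yP zP zT zyi.
have ij : i != j by apply: contraTneq yzj => <-; lia.
have ji : j != i by rewrite eq_sym.
have yi0 : (0 < y i)%N by lia.
have y'i : exch y j i i = (y i).-1.
  by rewrite ffunE eqxx (negbTE ij) addn0 subn1.
have y'j : exch y j i j = (y j).+1.
  by rewrite ffunE eqxx (negbTE ji) addn1 subn0.
have y'k k : k != i -> k != j -> exch y j i k = y k.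
  by move=> /negbTE ki /negbTE kj; rewrite ffunE ki kj addn0 subn0.
have yT' : (\sum_k exch y j i k = g [set: T]%SET)%N.
  have := @sum_exch _ y j i [set: T]%SET ji yi0.
  by rewrite !finset.in_setT !sum_setT -yT; clear; lia.
have lt' : (\sum_k (exch y j i k - z k) < n)%N.
  rewrite -ltnS; apply: leq_trans ltn; rewrite ltnS.
  rewrite (bigD1 i) //= [ltnRHS](bigD1 i) //= -addSn leq_add //.
    by rewrite y'i; lia.
  apply: leq_sum => k ki; have [->|kj] := eqVneq k j; first by rewrite y'j; lia.
  by rewrite y'k.
have := IH _ yP' yT' lt'.
have := @sum_shift _ _ (fun k => reported_value (v k) (y k))
  (fun k => reported_value (v k) (exch y j i k)) i j ij
  (fun k ki kj => congr1 (reported_value (v k)) (esym (y'k k ki kj))).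
(* This is the claimed bound as a function of the current allocation; one exchange lowers its sum by
   exactly [c i + d j]. *)
pose cost (w : {ffun T -> nat}) k := (w k - z k)%:R * c k + (z k - w k)%:R * d k.
have := @sum_shift _ _ (cost y) (cost (exch y j i)) i j ij
  (fun k ki kj => congr1 (fun t => (t - z k)%:R * c k + (z k - t)%:R * d k)
                    (esym (y'k k ki kj))).
rewrite /cost y'i y'j.
have [p yp] : exists p, y i = p.+1 by exists (y i).-1; lia.
rewrite yp /= !reported_valueS.
have -> : (p.+1 - z i = (p - z i).+1)%N by lia.
have -> : (z i - p.+1 = 0)%N by lia.
have -> : (z i - p = 0)%N by lia.
have -> : (y j - z j = 0)%N by lia.
have -> : ((y j).+1 - z j = 0)%N by lia.
have -> : (z j - y j = (z j - (y j).+1).+1)%N by lia.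
have zj0 : (0 < z j)%N by lia.
have := step i j ij zj0 zP'.
have : v i p.+1 <= v i (z i).+1 by apply: vanti; lia.
have : v j (z j) <= v j (y j).+1 by apply: vanti.
rewrite -!natr1; lra.
Qed.

(** * The polymatroid of an environment and local optimality conditions for outcomes *)

Section Environment.
Context {R : realType} {M : nat} (E : environment R M).
Implicit Types (y z : {ffun 'I_(agents E) -> nat}).
Implicit Types (V : 'I_(agents E) -> nat -> R).

Lemma f_ge0 (S : {set 'I_(agents E)}) : 0 <= f E S.
Proof. by rewrite -(f_normalized E); apply: f_monotone; apply: finset.sub0set. Qed.

Lemma ftilde_set0 : ftilde (finset.set0 : {set 'I_(agents E)}) = 0%N.
Proof. by rewrite /ftilde f_normalized mul0r truncn0. Qed.

Lemma ftilde_setT : ftilde [set: 'I_(agents E)]%SET = M.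
Proof. by rewrite /ftilde f_total mul1r natrK. Qed.

Lemma ftilde_le (S : {set 'I_(agents E)}) : (ftilde S <= M)%N.
Proof.
rewrite -[leqRHS]ftilde_setT; apply: le_truncn.
by rewrite ler_wpM2r // f_monotone // finset.subsetT.
Qed.

(** Submodularity makes the expression under the absolute value nonnegative, so the infimum bounds
    the expression itself. *)
Lemma min_distance_le (S : {set 'I_(agents E)}) i j :
  i \notin S -> j \notin S -> i != j -> min_distance (f E) <=
  f E (i |: S)%SET + f E (j |: S)%SET - f E S - f E (i |: (j |: S))%SET.
Proof.
move=> iS jS ij; apply: ge_inf.
  by exists 0 => _ [? [? [? [_ _ _ ->]]]].
exists S, i, j; split => //; rewrite ger0_norm //.
have := f_submodular (i |: S)%SET (j |: S)%SET.
have -> : ((i |: S) :|: (j |: S) = i |: (j |: S))%SET.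
  apply/finset.setP => k; rewrite !finset.inE.
  by case: (k == i); case: (k == j); case: (k \in S).
have -> : ((i |: S) :&: (j |: S) = S)%SET.
  apply/finset.setP => k; rewrite !finset.inE.
  have [->|_] := eqVneq k i; last by case: (k == j); case: (k \in S).
  by rewrite (negbTE ij) (negbTE iS).
lra.
Qed.

(* Rounding down loses less than 1 for each of two terms, and the bound on [M]
   makes up for 2. *)
Lemma ftilde_submodular : submodular (@ftilde _ _ E).
Proof.
apply: submodular_local => S i j iS jS ij.
have D0 := min_distance_gt0 E; have := divisions_ge E.
rewrite ler_pdivrMr // => MD.
have dist := min_distance_le iS jS ij.
have M0 : 0 <= M%:R :> R by [].
have fl A : ((ftilde A)%:R <= f E A * M%:R < (ftilde A).+1%:R).
  by apply: truncn_itv; rewrite mulr_ge0 // f_ge0.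
have /andP[l1 _] := fl S; have /andP[l2 _] := fl (i |: (j |: S))%SET.
have /andP[_ u1] := fl (i |: S)%SET; have /andP[_ u2] := fl (j |: S)%SET.
have lt : (ftilde S + ftilde (i |: (j |: S))%SET)%:R <
    ((ftilde (i |: S)%SET).+1 + (ftilde (j |: S)%SET).+1)%:R - 2 :> R.
  by rewrite !natrD; nra.
have : (ftilde S + ftilde (i |: (j |: S))%SET + 2 <
    (ftilde (i |: S)%SET).+1 + (ftilde (j |: S)%SET).+1)%N.
  by rewrite -(ltr_nat R) natrD; lra.
by clear; lia.
Qed.

Lemma feasible_le y i : feasible y -> (y i <= ftilde [set i]%SET)%N.
Proof. by move=> /(_ [set i]%SET); rewrite finset.big_set1. Qed.

Lemma feasible_sum y : feasible y -> (\sum_k y k <= M)%N.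
Proof.
by move=> /(_ [set: _]%SET); rewrite ftilde_setT sum_setT.
Qed.

Lemma objective_inc V y i :
  objective V (inc y i) = objective V y + (V i (y i).+1 + beta E / M%:R).
Proof.
apply/eqP; rewrite addrC -subr_eq; apply/eqP.
rewrite (@sum_shift1 _ _ _ _ i) => [|k /negbTE ki].
  rewrite ffunE eqxx addn1 reported_valueS -natr1 /=; ring.
by rewrite ffunE ki addn0.
Qed.

Lemma objective_exch V y i j : i != j -> (0 < y j)%N ->
  objective V (exch y i j) = objective V y + (V i (y i).+1 - V j (y j)).
Proof.
move=> ij yj; apply/eqP; rewrite addrC -subr_eq; apply/eqP.
rewrite (@sum_shift _ _ _ _ i j) // => [|k /negbTE ki /negbTE kj].
  rewrite !ffunE !eqxx (negbTE ij) (eq_sym j) (negbTE ij) addn1 addn0 subn1 subn0.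
  rewrite reported_valueS; case: (y j) yj => // p _; rewrite reported_valueS /=.
  rewrite -!natr1; ring.
by rewrite ffunE ki kj addn0 subn0.
Qed.

Lemma outcome_inc V y i : vcg_outcome V y -> feasible (inc y i) ->
  V i (y i).+1 + beta E / M%:R <= 0.
Proof. by move=> [_ opt] /opt; rewrite objective_inc gerDl. Qed.

Lemma outcome_dec V y i : vcg_outcome V y -> (0 < y i)%N ->
  0 <= V i (y i) + beta E / M%:R.
Proof.
move=> [yP opt] yi.
pose y' : {ffun 'I_(agents E) -> nat} := [ffun k => (y k - (k == i))%N].
have ye : y = inc y' i.
  apply/ffunP => k; rewrite !ffunE.
  by have [->|_] := eqVneq k i; rewrite ?subn0 ?addn0 ?subnK.
have yi' : (y i = (y' i).+1)%N by rewrite ye !ffunE eqxx; lia.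
have /opt : feasible y'.
  move=> S; apply: leq_trans (yP S); apply: leq_sum => k _.
  by rewrite ffunE leq_subr.
by rewrite [in objective _ y]ye objective_inc yi' lerDl.
Qed.

Lemma outcome_exch V y i j : vcg_outcome V y -> i != j -> (0 < y j)%N ->
  feasible (exch y i j) -> V i (y i).+1 <= V j (y j).
Proof.
move=> [_ opt] ij yj /opt; rewrite objective_exch // gerDl subr_le0 //.
Qed.

(** With positive marginals an outcome admits no further unit, and all maximal points of the
    polymatroid have the same total. *)
Lemma outcome_total V y :
  (forall i m, (0 < m)%N -> 0 < V i m + beta E / M%:R) ->
  vcg_outcome V y -> (\sum_k y k = M)%N.
Proof.
move=> pos yV; transitivity (ftilde [set: 'I_(agents E)]%SET);
  last exact: ftilde_setT.
apply: polymatroid_maximal ftilde_submodular ftilde_set0 _ _; first by case: yV.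
by move=> i /(outcome_inc yV); rewrite leNgt pos.
Qed.

End Environment.

(** * Slope bound and concavity of utilities *)

Lemma utility_slope {R : realType} (alpha beta : R) (u : R -> R) (a b : R) :
  utility alpha beta u -> 0 <= a -> a < b -> beta * (b - a) <= u b - u a.
Proof.
move=> [_ _ _ ucont uder] a0 ab.
(* The intermediate point is interior, so continuity at the endpoint is enough when [a = 0]. *)
have [||c] := @MVT _ u (derive1 u) a b ab.
- move=> x; rewrite in_itv /= => /andP[ax _].
  have [|xder _] := uder x; first by rewrite in_itv /= andbT (le_lt_trans a0).
  by rewrite derive1E; apply: derivableP.
- apply: continuous_subspaceW ucont => x /=; rewrite !in_itv /= andbT.
  by move=> /andP[ax _]; apply: le_trans ax.
rewrite in_itv /= => /andP[ac _] ->.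
have [|_ /andP[/ltW bc _]] := uder c; first by rewrite in_itv /= andbT (le_lt_trans a0).
by rewrite ler_wpM2r // subr_ge0 ltW.
Qed.

Lemma utility_midpoint {R : realType} (alpha beta : R) (u : R -> R) (a b : R) :
  utility alpha beta u -> 0 <= a -> 0 <= b -> u a + u b <= 2 * u ((a + b) / 2).
Proof.
move=> [_ uconv _ _ _] a0 b0.
have half_ge0 : 0 <= 2^-1 :> R by lra.
have half_le1 : 2^-1 <= 1 :> R by lra.
have := uconv (Itv01 half_ge0 half_le1) a b.
rewrite !inE /= !in_itv /= a0 b0 => /(_ isT isT); rewrite !convRE /=.
have -> : conv (Itv01 half_ge0 half_le1) (a : convex_lmodType R^o) b = (a + b) / 2.
  by rewrite [LHS](convRE a b) /= /unstable.onem; field.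
rewrite /unstable.onem; lra.
Qed.

(** * True marginals, their rounding, and the upper bound on the welfare loss *)

Section Marginals.
Context {R : realType} {M : nat} (E : environment R M).
Context (M_gt0 : (0 < M)%N).
Implicit Types (y z : {ffun 'I_(agents E) -> nat}).
Implicit Types (V : 'I_(agents E) -> nat -> R).

Lemma true_marginal_ge0 n m : (0 < m)%N -> 0 <= true_marginal E n m.
Proof.
case: m => // m _; rewrite /true_marginal /=.
have M0 : 0 < M%:R :> R by rewrite ltr0n.
have := @utility_slope _ _ _ _ (m%:R / M%:R) (m.+1%:R / M%:R) (u_utility n).
rewrite divr_ge0 // ltr_pM2r ?invr_gt0 // ltr_nat ltnSn => /(_ isT isT).
rewrite -mulrBl -natrB // subSnn mul1r; lra.
Qed.

Lemma true_marginal_antitone n : antitone_marginals (true_marginal E n).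
Proof.
have step m : true_marginal E n m.+2 <= true_marginal E n m.+1.
  rewrite /true_marginal /=.
  have := @utility_midpoint _ _ _ _ (m%:R / M%:R) (m.+2%:R / M%:R) (u_utility n).
  rewrite !divr_ge0 // => /(_ isT isT).
  have -> : (m%:R / M%:R + m.+2%:R / M%:R) / 2 = m.+1%:R / M%:R :> R.
    by rewrite -[m.+2]addn2 -[m.+1]addn1 !natrD; field; rewrite pnatr_eq0 -lt0n.
  lra.
move=> [//|m] [//|m'] _; rewrite ltnS => mm'.
by have /nonincreasing_seqP := step; apply.
Qed.

Lemma reported_value_true n k : reported_value (true_marginal E n) k =
  u E n (k%:R / M%:R) - u E n 0 - beta E * k%:R / M%:R.
Proof.
elim: k => [|k IH]; first by rewrite /reported_value big_geq // mul0r mulr0 mul0r; ring.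
rewrite reported_valueS IH /true_marginal /= -natr1; ring.
Qed.

(** The [beta] shares in the objective restore what the surrogate marginals subtract, so a truthful
    outcome maximizes social welfare. *)
Lemma objective_true y :
  objective (true_marginal E) y = social_welfare y - \sum_n u E n 0.
Proof.
rewrite /social_welfare -sumrB; apply: eq_bigr => n _.
rewrite reported_value_true; ring.
Qed.

Context {delta : R}.
Context (delta_gt0 : 0 < delta).

Lemma rounded_report_antitone n m m' : (0 < m)%N -> (m <= m')%N ->
  rounded_report E delta n m' <= rounded_report E delta n m.
Proof.
move=> m0 mm'; have vle : true_marginal E n m' / delta <= true_marginal E n m / delta.
  by rewrite ler_pM2r ?invr_gt0 // true_marginal_antitone.
rewrite /rounded_report; case: ifP => h'; case: ifP => h; rewrite ?le_ceil ?le_floor //.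
  by move: h; rewrite (leq_trans mm' h').
(* The remaining case has [m] in the first half and [m'] in the second, where the chain is floor,
   floor, ceiling. *)
rewrite (le_trans (le_floor vle)) //.
apply: (@le_trans _ _
  (Num.floor (Num.ceil (true_marginal E n m / delta))%:~R : int)).
  by apply: le_floor; apply: ceil_ge.
by rewrite intrKfloor.
Qed.

Lemma rounded_report_ge0 n m : (0 < m)%N -> 0 <= rounded_report E delta n m.
Proof.
move=> m0; have v0 : 0 <= true_marginal E n m / delta.
  by rewrite divr_ge0 ?true_marginal_ge0 // ltW.
rewrite /rounded_report; case: ifP => _; last by rewrite floor_ge0.
by rewrite -(ceil0 R) le_ceil.
Qed.

Lemma rounded_up n m : (m <= M./2)%N ->
  0 <= (rounded_report E delta n m)%:~R * delta - true_marginal E n m <= delta.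
Proof.
move=> mM; rewrite /rounded_report mM; set v := true_marginal E n m.
have /andP[l r] := ceil_itv (v / delta).
move: l r; rewrite ltr_pdivlMr // ler_pdivrMr // rmorphB /=; lra.
Qed.

Lemma rounded_down n m : (M./2 < m)%N ->
  - delta <= (rounded_report E delta n m)%:~R * delta - true_marginal E n m <= 0.
Proof.
move=> mM; rewrite /rounded_report leqNgt mM /=; set v := true_marginal E n m.
have /andP[l r] := floor_itv (v / delta).
move: l r; rewrite ltr_pdivrMr // ler_pdivlMr // rmorphD /=; lra.
Qed.

Lemma beta_share_gt0 : 0 < beta E / M%:R.
Proof. by rewrite divr_gt0 ?ltr0n ?beta_gt0. Qed.

Lemma rounded_report_is_bid n : is_bid delta n (rounded_report E delta n).
Proof.
split=> [m m' m0 mm' _|m /andP[m0 _]]; first exact: rounded_report_antitone.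
rewrite gt_eqF // ltr_wpDl ?beta_share_gt0 //.
by rewrite mulr_ge0 ?(ltW delta_gt0) // ler0z rounded_report_ge0.
Qed.

Context (M_even : ~~ odd M).

Lemma welfare_loss_le y z : vcg_outcome (true_marginal E) y ->
  vcg_outcome (scaled delta (rounded_report E delta)) z ->
  0 <= social_welfare y - social_welfare z <= M%:R * delta.
Proof.
move=> yV zW.
have sum_y : (\sum_k y k = M)%N.
  apply: outcome_total yV => i m m0.
  by rewrite ltr_wpDl ?beta_share_gt0 ?true_marginal_ge0.
have sum_z : (\sum_k z k = M)%N.
  apply: outcome_total zW => i m m0.
  rewrite ltr_wpDl ?beta_share_gt0 // mulr_ge0 ?ler0z ?rounded_report_ge0 //.
  exact: ltW.
have [yP yopt] := yV; have [zP zopt] := zW.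
have := yopt z zP; rewrite !objective_true => swyz.
apply/andP; split; first lra.
(* Both allocations hand out [M] units, so the [beta] shares cancel. *)
have -> : social_welfare y - social_welfare z =
    \sum_k reported_value (true_marginal E k) (y k) -
    \sum_k reported_value (true_marginal E k) (z k).
  have tot (w : {ffun 'I_(agents E) -> nat}) : (\sum_k w k = M)%N ->
      \sum_k reported_value (true_marginal E k) (w k) =
      social_welfare w - \sum_n u E n 0 - beta E.
    move=> wM; have -> : beta E = \sum_k beta E * (w k)%:R / M%:R.
      by rewrite -mulr_suml -mulr_sumr -natr_sum wM mulfK // pnatr_eq0 -lt0n.
    rewrite -!sumrB; apply: eq_bigr => n _; exact: reported_value_true.
  by rewrite !tot //; lra.
(* The next unit of an agent holding [z k] was rounded down, hence possibly undervalued, only if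
   [z k] is at least [M./2]. On the receiving side a unit is overvalued by at most [delta]. *)
pose c k := if (M./2 <= z k)%N then delta else 0.
have := @exchange_loss _ _ _ (true_marginal E) c (fun=> delta) y z
  (@ftilde_submodular _ _ E) (ftilde_set0 E) yP zP.
rewrite ftilde_setT => /(_ sum_y sum_z true_marginal_antitone).
move=> /(_ _)/le_trans; apply.
  move=> i j ij zj /(outcome_exch zW ij zj); rewrite /scaled.
  set Wi := _%:~R * delta; set Wj := _%:~R * delta => WW.
  have : true_marginal E i (z i).+1 <= Wi + c i.
    rewrite /c; case: leqP => h.
      by have /andP[] := @rounded_down i (z i).+1 h; rewrite -/Wi; lra.
    by have /andP[] := @rounded_up i (z i).+1 h; rewrite -/Wi; lra.
  have : Wj <= true_marginal E j (z j) + delta.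
    case: (leqP (z j) M./2) => h.
      by have /andP[] := rounded_up j h; rewrite -/Wj; lra.
    by have /andP[] := rounded_down j h; rewrite -/Wj; lra.
  lra.
(* Of the [t] units moved, [a] come from agents for whom [c] is [delta]. *)
pose a := (\sum_(k | M./2 <= z k) (y k - z k))%N.
pose t := (\sum_k (z k - y k))%N.
have -> : \sum_k ((y k - z k)%:R * c k + (z k - y k)%:R * delta) =
    (a + t)%:R * delta.
  rewrite big_split /= natrD mulrDl; congr +%R; last by rewrite natr_sum mulr_suml.
  rewrite natr_sum mulr_suml [RHS]big_mkcond; apply: eq_bigr => k _.
  by rewrite /c; case: ifP; rewrite ?mulr0.
rewrite ler_pM2r // ler_nat.
have tle : (t <= M)%N by rewrite -sum_z; apply: leq_sum => k _; rewrite leq_subr.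
have te : (t = \sum_k (y k - z k))%N.
  have : (\sum_k (z k - y k) + \sum_k y k = \sum_k (y k - z k) + \sum_k z k)%N.
    by rewrite -!big_split; apply: eq_bigr => k _ /=; lia.
  by rewrite sum_y sum_z; rewrite -/t; clear; lia.
have [a0|a0] := posnP a; first by rewrite a0.
(* Such an agent [n] receives no unit, so the [t] received units are among the [M - z n] units of
   the others in [z]. Thus [a <= t <= M./2], and [a + t <= M]. *)
have [n zn yn] : exists2 n, (M./2 <= z n)%N & (z n < y n)%N.
  apply: contrapT => /forall2NP nex; move: a0; rewrite /a big1 // => k zk.
  by have [//|] := nex k; move/negP; rewrite -leqNgt => h; apply/eqP; rewrite subn_eq0.
have at_ : (a <= t)%N.
  by rewrite te /a [leqRHS](bigID (fun k => M./2 <= z k)%N) /= leq_addr.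
have tz : (t + z n <= M)%N.
  rewrite -[leqRHS]sum_z /t (bigD1 n) //= [leqRHS](bigD1 n) //= addnC.
  have -> : (z n - y n = 0)%N by lia.
  by rewrite add0n leq_add2l; apply: leq_sum => k _; rewrite leq_subr.
have := odd_double_half M; rewrite (negbTE M_even) -addnn.
by move: at_ tz zn; clear; lia.
Qed.

End Marginals.

(** * Tie-breaking, completion of allocations, and dominance of the rounded report *)

Section Dominance.
Context {R : realType} {M : nat} (E : environment R M).
Implicit Types (y z : {ffun 'I_(agents E) -> nat}).
Implicit Types (V : 'I_(agents E) -> nat -> R) (n i : 'I_(agents E)).

(** A real-valued form of [is_bid], so that it also covers the zero vector used in the payment. *)
Definition regular_bid i (v : nat -> R) : Prop :=
  (forall m m', (0 < m)%N -> (m <= m')%N -> (m' <= ftilde [set i]%SET)%N ->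
     v m' <= v m) /\
  (forall m, (0 < m <= ftilde [set i]%SET)%N -> v m + beta E / M%:R != 0).

Lemma objectiveE V y :
  objective V y = surrogate_welfare V y + beta E / M%:R * (\sum_k y k)%:R.
Proof.
rewrite /objective big_split /=; congr +%R.
by rewrite natr_sum mulr_sumr; apply: eq_bigr => k _; rewrite mulrAC.
Qed.

(** The last unit of [i] in [y] has a nonnegative, hence positive, marginal including the [beta]
    share. By monotonicity so has her next unit in [y'], which would therefore have been allocated
    if feasible. *)
Lemma outcome_saturated V V' y y' i : vcg_outcome V y -> vcg_outcome V' y' ->
  V i = V' i -> regular_bid i (V i) -> (y' i < y i)%N -> ~ feasible (inc y' i).
Proof.
move=> yV yV' VV' [anti neq0] lt /(outcome_inc yV'); rewrite -VV' => le0.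
have yi0 : (0 < y i)%N by apply: leq_ltn_trans lt.
have cap : (y i <= ftilde [set i]%SET)%N by apply: feasible_le; case: yV.
have := outcome_dec yV yi0; have := anti _ _ (ltn0Sn _) lt cap.
have := neq0 (y i); rewrite yi0 cap => /(_ isT)/eqP; lra.
Qed.

Lemma outcome_sum_le V y z : (forall i, regular_bid i (V i)) ->
  vcg_outcome V y -> vcg_outcome V z -> (\sum_k y k <= \sum_k z k)%N.
Proof.
move=> reg yV zV; rewrite leqNgt; apply/negP.
move/(polymatroid_augment (@ftilde_submodular _ _ E) (ftilde_set0 E) zV.1 yV.1).
by move=> [i lt]; apply: outcome_saturated yV zV _ _ lt.
Qed.

(** Two outcomes have equal objectives and, by augmentation and saturation, equal totals; the [beta]
    shares depend on the total only. Hence OPT is independent of tie-breaking. *)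
Lemma surrogate_welfare_outcome V y z : (forall i, regular_bid i (V i)) ->
  vcg_outcome V y -> vcg_outcome V z ->
  surrogate_welfare V y = surrogate_welfare V z.
Proof.
move=> reg yV zV.
have e : (\sum_k y k = \sum_k z k)%N.
  by apply/eqP; rewrite eqn_leq !(@outcome_sum_le V).
have : objective V y = objective V z.
  by apply: le_anti; rewrite (zV.2 _ yV.1) (yV.2 _ zV.1).
by rewrite !objectiveE e => /addIr.
Qed.

(* The bids of the agents other than [n] agree in [V] and [V'], so only units of
   agent [n] can be missing from [y']. *)
Lemma outcome_complete V V' y y' n : vcg_outcome V y -> vcg_outcome V' y' ->
  (forall k, k != n -> V k = V' k) ->
  (forall k, k != n -> regular_bid k (V k)) ->
  exists x, [/\ feasible x, forall k, k != n -> x k = y' k,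
    (y' n <= x n)%N & (\sum_k y k <= \sum_k x k)%N].
Proof.
move=> yV yV' VV' reg.
suff complete x : feasible x -> (forall k, k != n -> x k = y' k) ->
    (y' n <= x n)%N ->
    exists x, [/\ feasible x, forall k, k != n -> x k = y' k,
      (y' n <= x n)%N & (\sum_k y k <= \sum_k x k)%N].
  by apply: (complete y') => //; case: yV'.
have [d] := ubnP (\sum_k y k - \sum_k x k)%N.
elim: d x => // d IH x ltd xP xk xn.
have [le|lt] := leqP (\sum_k y k) (\sum_k x k); first by exists x.
have [i xyi incP] :=
  polymatroid_augment (@ftilde_submodular _ _ E) (ftilde_set0 E) xP yV.1 lt.
have [ni|ni] := eqVneq i n.
  apply: (IH (inc x i)) => //.
  - have := sum_inc x i [set: _]%SET; rewrite finset.in_setT !sum_setT.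
    by move=> ->; rewrite addn1 subnS prednK ?subn_gt0 //.
  - by move=> k /[dup] kn /xk <-; rewrite ffunE ni (negbTE kn) addn0.
  - by rewrite ffunE; apply: leq_trans xn (leq_addr _ _).
(* A unit of another agent that fits into [x] also fits into the smaller [y'], where that agent is
   saturated. *)
case: (outcome_saturated yV yV' (VV' i ni) (reg i ni)); first by rewrite -xk.
move=> S; apply: leq_trans (incP S); apply: leq_sum => k _.
rewrite !ffunE leq_add2r; have [->//|kn] := eqVneq k n; by rewrite xk.
Qed.

Context {delta : R} (M_gt0 : (0 < M)%N) (delta_gt0 : 0 < delta) (M_even : ~~ odd M).

Lemma is_bid_regular n w : is_bid delta n w ->
  regular_bid n (fun m => (w m)%:~R * delta).
Proof.
move=> [anti neq0]; split=> [m m' m0 mm' cap|m /neq0 //].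
by rewrite ler_pM2r // ler_int anti.
Qed.

Definition rounding_error n k : R :=
  reported_value (fun m => (rounded_report E delta n m)%:~R * delta) k -
  reported_value (true_marginal E n) k.

(** The error at [a] is at most the peak at [M./2]. Since [b] lies within [M./2] units of the peak
    and each unit changes the error by at most [delta], the error at [b] is not much below it. *)
Lemma rounding_error_le n a b : (b <= M)%N ->
  rounding_error n a - rounding_error n b <= M%:R * delta / 2.
Proof.
move=> bM; set err := rounding_error n.
have errS k : err k.+1 = err k +
    ((rounded_report E delta n k.+1)%:~R * delta - true_marginal E n k.+1).
  by rewrite /err /rounding_error !reported_valueS; ring.
have up k d : (k + d <= M./2)%N -> 0 <= err (k + d)%N - err k <= d%:R * delta.
  elim: d => [|d IH] h; first by rewrite addn0 subrr mul0r lexx.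
  have /IH : (k + d <= M./2)%N by apply: leq_trans h; rewrite leq_add2l.
  rewrite addnS errS -natr1; have := @rounded_up _ _ E _ delta_gt0 n (k + d).+1.
  rewrite -addnS h => /(_ isT); lra.
have down k d : (M./2 <= k)%N -> - (d%:R * delta) <= err (k + d)%N - err k <= 0.
  move=> h; elim: d => [|d IH]; first by rewrite addn0 subrr mul0r oppr0 lexx.
  move: IH; rewrite addnS errS -natr1.
  have := @rounded_down _ _ E _ delta_gt0 n (k + d).+1.
  by rewrite ltnS (leq_trans h) ?leq_addr // => /(_ isT); lra.
have half : M%:R / 2 = (M./2)%:R :> R.
  have := odd_double_half M; rewrite (negbTE M_even) add0n => {1}<-.
  by rewrite -muln2 natrM; field.
rewrite mulrAC half.
have peak k : err k <= err M./2.
  have [/subnKC h|/ltnW/subnKC h] := leqP k M./2.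
    by have := up k (M./2 - k)%N; rewrite h => /(_ (leqnn _)); lra.
  by have := down M./2 (k - M./2)%N (leqnn _); rewrite h; lra.
have drop : err M./2 - err b <= (M./2)%:R * delta.
  have [h|h] := leqP b M./2.
    have := up b (M./2 - b)%N; rewrite subnKC // => /(_ (leqnn _)) /andP[_ le].
    by apply: le_trans le _; rewrite ler_pM2r // ler_nat leq_subr.
  have := down M./2 (b - M./2)%N (leqnn _); rewrite subnKC ?(ltnW h) //.
  move=> /andP[le _]; have : (b - M./2)%:R * delta <= (M./2)%:R * delta.
    rewrite ler_pM2r // ler_nat leq_subLR.
    have := odd_double_half M; rewrite (negbTE M_even) add0n addnn => ->.
    exact: bM.
  lra.
by have := peak a; lra.
Qed.

Lemma replace_scaled (W : 'I_(agents E) -> nat -> int) n w t :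
  replace (scaled delta (replace W n w)) n t = replace (scaled delta W) n t.
Proof. by apply/funext => k; rewrite /replace /scaled; case: ifP => // ->. Qed.

(** The usual VCG identity: up to a term free of her report, agent [n] receives the surrogate
    welfare in which she counts with her true marginals. *)
Lemma payoffE V n y z : payoff V n y z = u E n 0 +
  surrogate_welfare (replace V n (true_marginal E n)) y -
  surrogate_welfare (replace V n (fun=> 0)) z.
Proof.
rewrite /payoff /payment.
have -> : surrogate_welfare (replace V n (true_marginal E n)) y =
    surrogate_welfare V y +
    (reported_value (true_marginal E n) (y n) - reported_value (V n) (y n)).
  apply/eqP; rewrite addrC -subr_eq; apply/eqP.
  rewrite (@sum_shift1 _ _ _ _ n) /replace ?eqxx // => k /negbTE kn.
  by rewrite kn.
rewrite reported_value_true; ring.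
Qed.

Lemma dominant_rounded_report n :
  dominant E delta (M%:R * delta / 2) n (rounded_report E delta n).
Proof.
split; first exact: rounded_report_is_bid.
move=> w W wbid Wbid V V' y z y' z' yV zV yV' zV'.
pose U := scaled delta W.
have VU t : replace V n t = replace U n t by apply: replace_scaled.
have V'U t : replace V' n t = replace U n t by apply: replace_scaled.
have Vk k : k != n -> V k = U k.
  by move=> /negbTE kn; rewrite /V /U /scaled /replace kn.
have V'k k : k != n -> V' k = U k.
  by move=> /negbTE kn; rewrite /V' /U /scaled /replace kn.
have Ureg k : k != n -> regular_bid k (U k).
  by move=> /Wbid/is_bid_regular.
have Vn : V n = fun m => (rounded_report E delta n m)%:~R * delta.
  by rewrite /V /scaled /replace eqxx.
rewrite !payoffE !VU !V'U; rewrite !VU !V'U in zV zV'.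
have -> : surrogate_welfare (replace U n (fun=> 0)) z' =
    surrogate_welfare (replace U n (fun=> 0)) z.
  apply: surrogate_welfare_outcome zV' zV => k; rewrite /replace.
  case: ifPn => [_|/Ureg //]; split=> // m _.
  by rewrite add0r gt_eqF // beta_share_gt0.
set Vt := replace U n (true_marginal E n).
(* Optimality of [y] includes the [beta] shares, and [y'] may hand out fewer units than [y];
   completing it by units of [n] removes this deficit and cannot lower the welfare for [Vt]. *)
have [|k kn|x [xP xk xn xy]] := @outcome_complete V V' y y' n yV yV'.
- by move=> k kn; rewrite Vk ?V'k.
- by rewrite Vk //; apply: Ureg.
have gain : surrogate_welfare Vt y' <= surrogate_welfare Vt x.
  rewrite -subr_ge0 (@sum_shift1 _ _ _ _ n) /Vt /replace ?eqxx; last first.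
    by move=> k kn; rewrite xk.
  rewrite subr_ge0 -(subnKC xn).
  elim: (x n - y' n)%N => [|d IH]; first by rewrite addn0.
  by rewrite addnS reported_valueS (le_trans IH) // lerDl true_marginal_ge0.
have shift q : objective Vt q = objective V q +
    (reported_value (true_marginal E n) (q n) - reported_value (V n) (q n)).
  apply/eqP; rewrite addrC -subr_eq; apply/eqP.
  rewrite (@sum_shift1 _ _ _ _ n) /Vt /replace ?eqxx.
    by ring.
  by move=> k kn; rewrite (negbTE kn) Vk.
(* [V] weakly prefers [y] to [x], and passing from [V] to [Vt] subtracts the rounding error of [n].
   So [x] gains at most the error at [y n] minus that at [x n]. *)
have := yV.2 x xP; have := shift x; have := shift y; rewrite !objectiveE.
have : beta E / M%:R * (\sum_k y k)%:R <= beta E / M%:R * (\sum_k x k)%:R.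
  by rewrite ler_pM2l ?beta_share_gt0 // ler_nat.
have xM : (x n <= M)%N by apply: leq_trans (feasible_le n xP) (ftilde_le _).
have := @rounding_error_le n (y n) (x n) xM; rewrite /rounding_error -Vn.
lra.
Qed.

End Dominance.

(** * Two agents with linear utilities whose welfare loss approaches the bound *)

Lemma linear_utility {R : realType} (alpha beta s : R) :
  0 < s -> beta < s < alpha -> utility alpha beta (fun x => s * x).
Proof.
move=> s0 sb.
have scont : continuous (fun x : R => s * x).
  by move=> x; apply: cvgM; [exact: cvg_cst | exact: cvg_id].
split.
- by move=> x; rewrite in_itv /= andbT => x0; rewrite mulr_ge0 // ltW.
- move=> t x y _ _; rewrite !convRE /=.
  rewrite [leLHS](_ : _ = t%:num * - (s * x) + unstable.onem t%:num * - (s * y)) //.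
  by rewrite [conv t x y](convRE x y) /=; ring.
- by move=> x y _ _ xy; rewrite ltr_pM2l.
- exact: continuous_subspaceT.
- move=> x _.
  have der : is_derive x (1 : R) (fun x => s * x) s.
    have := @is_deriveZ _ _ _ id s x 1 1 (is_derive_id _ _).
    by rewrite /GRing.scale /= mulr1.
  split; first by case: der.
  by rewrite derive1E (@derive_val _ _ _ _ _ _ _ der).
Qed.

Section Extremal.
Context {R : realType} {M : nat} {eps t : R}.
Context (M_gt0 : (0 < M)%N) (M_even : ~~ odd M) (t_itv : 0 < t < eps).

(** The rank function of the uniform matroid of rank one on two points: only the total allocation is
    constrained. *)
Definition pair_f (S : {set 'I_2}) : R := (S != finset.set0)%:R.

Lemma pair_f_normalized : pair_f finset.set0 = 0.
Proof. by rewrite /pair_f eqxx. Qed.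

Lemma pair_f_monotone (A B : {set 'I_2}) : A \subset B -> pair_f A <= pair_f B.
Proof.
move=> AB; rewrite /pair_f ler_nat; case: (eqVneq B) => [B0|_] /=; last by case: eqP.
by move: AB; rewrite B0 finset.subset0 => ->.
Qed.

Lemma pair_f_submodular (A B : {set 'I_2}) :
  pair_f (A :|: B)%SET + pair_f (A :&: B)%SET <= pair_f A + pair_f B.
Proof.
rewrite /pair_f -!natrD ler_nat finset.setU_eq0.
have [->|A0] := eqVneq A; first by rewrite finset.set0I eqxx addn0.
have [->|B0] := eqVneq B; first by rewrite finset.setI0 eqxx.
by case: (_ == _).
Qed.

Lemma pair_f_total : pair_f [set: 'I_2]%SET = 1.
Proof.
rewrite /pair_f; case: eqP => // /finset.setP/(_ ord0).
by rewrite !finset.inE.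
Qed.

Lemma pair_min_distance : 1 <= min_distance pair_f.
Proof.
apply: lb_le_inf.
  exists `|pair_f (ord0 |: finset.set0)%SET + pair_f (ord_max |: finset.set0)%SET
    - pair_f finset.set0 - pair_f (ord0 |: (ord_max |: finset.set0))%SET|.
  by exists finset.set0, ord0, ord_max; split; rewrite ?finset.inE.
move=> _ [S [i [j [iS jS ij ->]]]].
(* Two distinct points outside [S] already exhaust ['I_2]. *)
have -> : S = finset.set0.
  apply/finset.setP => k; rewrite finset.in_set0; apply/negbTE.
  apply/negP => kS.
  have ki : k != i by apply: contraNneq iS => <-.
  have kj : k != j by apply: contraNneq jS => <-.
  move: ij ki kj; rewrite -!val_eqE /=.
  by case: i j k {iS jS kS} => [[|[|//]] ?] [[|[|//]] ?] [[|[|//]] ?].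
have ne k (A : {set 'I_2}) : pair_f (k |: A)%SET = 1.
  rewrite /pair_f; case: eqP => // /finset.setP/(_ k).
  by rewrite !finset.inE eqxx.
by rewrite !ne pair_f_normalized subr0 addrK normr1.
Qed.

Lemma pair_min_distance_gt0 : 0 < min_distance pair_f.
Proof. exact: lt_le_trans pair_min_distance. Qed.

Lemma M_ge2 : (2 <= M)%N.
Proof. by move: M_gt0 M_even; case: (M) => [|[|]]. Qed.

Lemma pair_divisions_ge : 2 / min_distance pair_f <= M%:R.
Proof.
rewrite ler_pdivrMr ?pair_min_distance_gt0 //.
apply: le_trans (_ : M%:R * 1 <= _); first by rewrite mulr1 ler_nat M_ge2.
by rewrite ler_wpM2l // pair_min_distance.
Qed.

(* With [delta = eps / M] all marginals are [2 delta - t / M] for the first agent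
   and [t / M] for the second, so that those of the first agent past M/2 and those
   of the second up to M/2 are both rounded to [delta]. *)
Definition pair_slope (n : 'I_2) : R :=
  if n == ord0 then 1 + 2 * eps - t else 1 + t.

Lemma pair_utility n :
  utility (1 + 2 * eps) 1 (fun x => pair_slope n * x).
Proof.
move: t_itv => /andP[t0 te].
by apply: linear_utility; rewrite /pair_slope; case: ifP => _; lra.
Qed.

Lemma pair_alpha_gt0 : 0 < 1 + 2 * eps.
Proof. by move: t_itv => /andP[t0 te]; lra. Qed.

Definition pair_env : environment R M :=
  @Environment R M 2 pair_f (1 + 2 * eps) 1 (fun n x => pair_slope n * x)
    pair_f_normalized pair_f_monotone pair_f_submodular pair_f_total
    pair_min_distance_gt0 pair_divisions_ge pair_alpha_gt0 ltr01 pair_utility.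

Definition pair_alloc (a b : nat) : {ffun 'I_(agents pair_env) -> nat} :=
  [ffun k : 'I_2 => if k == ord0 then a else b].

Lemma pair_sum (F : 'I_2 -> R) : \sum_k F k = F ord0 + F ord_max.
Proof.
by rewrite big_ord_recl big_ord1; congr (_ + F _); apply/val_inj.
Qed.

Lemma pair_feasible a b : (a + b = M)%N -> feasible (pair_alloc a b).
Proof.
move=> abM S; rewrite /ftilde /= /pair_f.
have [->|S0] := eqVneq S; first by rewrite finset.big_set0.
rewrite mul1r natrK -abM.
apply: leq_trans (_ : \sum_(k < 2) pair_alloc a b k <= _)%N.
  by rewrite [leqRHS](bigID (mem S)) /= leq_addr.
by rewrite !big_ord_recl big_ord0 !ffunE /= addn0.
Qed.

(** Since [t < eps], the first agent has the larger slope. *)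
Lemma pair_outcome_true : vcg_outcome (true_marginal pair_env) (pair_alloc M 0).
Proof.
move: t_itv => /andP[t0 te].
split=> [|y yP]; first by apply: pair_feasible; rewrite addn0.
rewrite !objective_true // lerD2r /social_welfare !pair_sum /= !ffunE /=.
rewrite /pair_slope /=.
have : ((y ord0)%:R + (y ord_max)%:R <= M%:R :> R).
  have := feasible_sum yP; rewrite -(ler_nat R) natr_sum.
  by rewrite (pair_sum (fun k => (y k)%:R)).
set a := _%:R; set b := _%:R => abM.
have b0 : 0 <= b by rewrite ler0n.
have Mi0 : 0 < M%:R^-1 :> R by rewrite invr_gt0 ltr0n.
rewrite !mulrA -!mulrDl ler_pM2r // mulr0 addr0.
nra.
Qed.

Lemma pair_rounded_report n m : (0 < m)%N ->
  rounded_report pair_env (eps / M%:R) n m =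
    ((n == ord0) + (m <= M./2)%N)%:Z.
Proof.
move: t_itv => /andP[t0 te]; case: m => // m _; rewrite /rounded_report.
have Mn0 : M%:R != 0 :> R by rewrite pnatr_eq0 -lt0n.
have eps0 : 0 < eps by apply: lt_trans te.
have -> : true_marginal pair_env n m.+1 / (eps / M%:R) =
    if n == ord0 then 2 - t / eps else t / eps.
  rewrite /true_marginal /= /pair_slope -natr1.
  by case: ifP => _; field; rewrite Mn0 gt_eqF.
have q0 : 0 < t / eps by rewrite divr_gt0.
have q1 : t / eps < 1 by rewrite ltr_pdivrMr // mul1r.
case: ifP => _; case: ifP => _ /=.
- by apply: ceil_def; rewrite ?rmorphB /=; apply/andP; split; lra.
- by apply: ceil_def; rewrite ?rmorphB /=; apply/andP; split; lra.
- by apply: floor_def; rewrite ?rmorphD /=; apply/andP; split; lra.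
- by apply: floor_def; rewrite ?rmorphD /=; apply/andP; split; lra.
Qed.

Lemma pair_rounded_value n k :
  reported_value (scaled (eps / M%:R) (rounded_report pair_env (eps / M%:R)) n) k =
  ((n == ord0) * k + minn k M./2)%:R * (eps / M%:R).
Proof.
elim: k => [|k IH]; first by rewrite /reported_value big_geq // muln0 min0n mul0r.
rewrite reported_valueS IH /scaled pair_rounded_report // -mulrDl; congr (_ * _).
rewrite -[(_%:Z)%:~R]/(_%:R) -natrD; congr (_%:R).
by rewrite /minn; case: (n == ord0); case: (ltnP k M./2); case: (ltnP k.+1 M./2); lia.
Qed.

Lemma pair_outcome_rounded :
  vcg_outcome (scaled (eps / M%:R) (rounded_report pair_env (eps / M%:R)))
    (pair_alloc M./2 M./2).
Proof.
move: t_itv => /andP[t0 te].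
have halfM : (M./2 + M./2 = M)%N.
  by have := odd_double_half M; rewrite (negbTE M_even) add0n addnn.
split=> [|y yP]; first exact: pair_feasible.
rewrite /objective !pair_sum !pair_rounded_value !ffunE /= !mul1n !mul0n !add0n.
have yM : (y ord0 + y ord_max <= M)%N.
  have := feasible_sum yP; rewrite !big_ord_recl big_ord0 addn0.
  by have -> : lift ord0 ord0 = ord_max :> 'I_2 by apply/val_inj.
move: (y ord0) (y ord_max) yM => a b yM.
have d0 : 0 < eps / M%:R by rewrite divr_gt0 ?ltr0n // (lt_trans t0 te).
have Mi0 : 0 < M%:R^-1 :> R by rewrite invr_gt0 ltr0n.
(* This is the reported value in units of [delta]. Giving everything to the first agent attains the
   same maximum, but it suffices that the equal split is one of the possible outcomes. *)
have le1 : (a + minn a M./2 + minn b M./2)%:R <=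
    (M./2 + minn M./2 M./2 + minn M./2 M./2)%:R :> R.
  by rewrite ler_nat minnn; move: yM halfM; clear; lia.
have le2 : (a + b)%:R <= (M./2 + M./2)%:R :> R by rewrite ler_nat halfM.
have := ler_wpM2r (ltW d0) le1; have := ler_wpM2r (ltW Mi0) le2.
rewrite !natrD !mulrDl !mul1r; lra.
Qed.

Lemma pair_welfare_difference :
  welfare_differences M (eps / M%:R) (eps - t).
Proof.
move: t_itv => /andP[t0 te].
exists pair_env, (pair_alloc M 0), (pair_alloc M./2 M./2).
split; [exact: pair_outcome_true | exact: pair_outcome_rounded |].
rewrite /social_welfare !pair_sum !ffunE /= /pair_slope /=.
have Mn0 : M%:R != 0 :> R by rewrite pnatr_eq0 -lt0n.
have -> : (M./2)%:R / M%:R = 2^-1 :> R.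
  have := odd_double_half M; rewrite (negbTE M_even) add0n => e.
  have : M%:R = (M./2)%:R * 2 :> R by rewrite -{1}e -muln2 natrM.
  move=> e2; rewrite e2 in Mn0 *; field; move: Mn0.
  by rewrite mulf_eq0 => /norP[].
(* The two welfares are [1 + 2 * eps - t] and [1 + eps]. *)
rewrite divff // mul0r mulr0 ger0_norm; lra.
Qed.

End Extremal.

(** * Dominance, and [eps] as the least upper bound of the welfare differences *)

Theorem theorem4p5 (R : realType) (M : nat) (eps : R)
    (M_gt0 : (0 < M)%N) (M_even : ~~ odd M) (eps_gt0 : 0 < eps) :
  let delta := eps / M%:R in
  [/\ forall (E : environment R M) (n : 'I_(agents E)),
        dominant E delta (eps / 2) n (rounded_report E delta n),
      supremums (welfare_differences M delta) eps &
      eps = M%:R * delta].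
Proof.
move=> delta.
have epsE : eps = M%:R * delta by rewrite mulrC divfK // pnatr_eq0 -lt0n.
have delta_gt0 : 0 < delta by rewrite divr_gt0 ?ltr0n.
split=> //; first by move=> E n; rewrite epsE; apply: dominant_rounded_report.
split=> [_ [E [y [z [yV zW ->]]]]|b ub].
  have := welfare_loss_le M_gt0 delta_gt0 M_even yV zW; rewrite -epsE.
  by move=> /andP[ge0 le]; rewrite ger0_norm.
rewrite leNgt; apply/negP => b_lt.
(* The first term puts [eps - t] above [b]; the second keeps [t] below [eps] even if [b] is far
   below 0. *)
pose t := Num.min ((eps - b) / 2) (eps / 2).
have t_itv : 0 < t < eps.
  by rewrite lt_min gt_min !divr_gt0 ?subr_gt0 //=; apply/orP; right; lra.
have := ub _ (pair_welfare_difference M_gt0 M_even t_itv).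
have : t <= (eps - b) / 2 by rewrite ge_min lexx.
lra.
Qed.
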